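(* For every integer $k\ge 1$, as formal power series in $x$, $$\sum_{n \geq 0} D_{2k}(n) x^n = \sum_{n \geq 0} r_{2k}(n) x^n = \frac{G_{k,k}(x)}{(1-x)^{k^2+1}}$$ and $$\sum_{n \geq 0} r_{2k+1}(n) x^n = \frac{G_{k,k+1}(x)}{(1-x)^{k^2+k+1}}.$$
   Context: For $m\ge 0$ let $b(m)=\binom{m}{\lfloor m/2\rfloor}$ and let $D_k(n)=\det\left(b(k+i+j)\right)_{i,j=0}^{n-1}$, with $D_k(0)=1$. For $k\ge 0$ let $r_k(x)=\prod_{j=1}^{k}\left(\frac{j+x}{j}\right)^{\min(j,k-j)}$ (a polynomial in $x$). For integers $a,b\ge 1$ let $F_a^b(x)=\left(X^{a-1}D^a\right)^b\frac{1}{1-x}$, where $X$ is the operator of multiplication by $x$ and $D=\frac{d}{dx}$. The polynomial $G_{a,b}(x)$ is defined by $$F_a^b(x)=\left(\prod_{j=0}^{b-1}\frac{(a+j)!}{j!}\right)\, x^{a-1}\,\frac{G_{a,b}(x)}{(1-x)^{ab+1}}.$$ (It is a known fact that $G_{a,b}(x)$ is indeed a polynomial, of degree $(a-1)(b-1)$.) *)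

(* Defs.v *)
From HB Require Import structures.
From mathcomp Require Import all_boot all_order all_algebra.
From mathcomp Require Import boolp classical_sets.

Set Implicit Arguments.
Unset Strict Implicit.
Unset Printing Implicit Defensive.

Import GRing.Theory Num.Theory.
Local Open Scope ring_scope.

(* The formal power series with coefficient [f n] of x^n.  The ring structure
   below has the Cauchy product as multiplication, and the units are the series
   with invertible constant term. *)
Record fps (R : Type) := FPS { coefs :> nat -> R }.

Notation "\fps_ n E" := (FPS (fun n : nat => E))
  (at level 36, n at level 0, E at level 36, format "\fps_ n  E") : ring_scope.

Lemma fpsP (R : Type) (f g : fps R) : (forall n, f n = g n) -> f = g.
Proof. by case: f g => f [g] /= /funext ->. Qed.

HB.instance Definition _ (R : Type) := gen_eqMixin (fps R).
HB.instance Definition _ (R : Type) := gen_choiceMixin (fps R).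

Section Zmodule.
Variable R : zmodType.
Implicit Types f g h : fps R.

Definition fps_zero : fps R := \fps_n 0.
Definition fps_opp f : fps R := \fps_n (- f n).
Definition fps_add f g : fps R := \fps_n (f n + g n).

Fact fps_addA : associative fps_add.
Proof. by move=> f g h; apply: fpsP => n /=; rewrite addrA. Qed.
Fact fps_addC : commutative fps_add.
Proof. by move=> f g; apply: fpsP => n /=; rewrite addrC. Qed.
Fact fps_add0 : left_id fps_zero fps_add.
Proof. by move=> f; apply: fpsP => n /=; rewrite add0r. Qed.
Fact fps_addN : left_inverse fps_zero fps_opp fps_add.
Proof. by move=> f; apply: fpsP => n /=; rewrite addNr. Qed.

HB.instance Definition _ :=
  GRing.isZmodule.Build (fps R) fps_addA fps_addC fps_add0 fps_addN.

End Zmodule.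

Section Ring.
Variable R : comNzRingType.
Implicit Types (f g h : fps R) (p q : {poly R}).

Definition fps_of_poly p : fps R := \fps_n p`_n.

Definition fps_one : fps R := \fps_n (n == 0)%:R.
Definition fps_mul f g : fps R := \fps_n (\sum_(i < n.+1) f i * g (n - i)%N).

Let trunc n f : {poly R} := \poly_(i < n.+1) f i.

Let trunc_mul n f g i : (i <= n)%N ->
  fps_mul f g i = (trunc n f * trunc n g)`_i.
Proof.
move=> lein; rewrite coefM /=; apply: eq_bigr => -[j ltji] _ /=.
rewrite ltnS in ltji; rewrite !coef_poly !ltnS (leq_trans ltji lein).
by rewrite (leq_trans (leq_subr j i) lein).
Qed.

Let trunc_truncM n f g : forall i, (i <= n)%N ->
  (trunc n (fps_mul f g))`_i = (trunc n f * trunc n g)`_i.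
Proof. by move=> i lein; rewrite coef_poly ltnS lein (@trunc_mul n). Qed.

Fact fps_mulC : commutative fps_mul.
Proof.
by move=> f g; apply: fpsP => n; rewrite !(@trunc_mul n _ _ _ (leqnn n)) mulrC.
Qed.

Fact fps_mulA : associative fps_mul.
Proof.
move=> f g h; apply: fpsP => n; rewrite !(@trunc_mul n _ _ _ (leqnn n)).
transitivity (trunc n f * (trunc n g * trunc n h))`_n.
  rewrite !coefM; apply: eq_bigr => i _.
  by rewrite trunc_truncM // leq_subr.
rewrite mulrA !coefM; apply: eq_bigr => -[i lti] _ /=.
by rewrite trunc_truncM.
Qed.

Fact fps_mul1 : left_id fps_one fps_mul.
Proof.
move=> f; apply: fpsP => n /=.
by rewrite big_ord_recl /= mul1r subn0 big1 ?addr0 // => i _; rewrite mul0r.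
Qed.

Fact fps_mulDl : left_distributive fps_mul +%R.
Proof.
move=> f g h; apply: fpsP => n /=; rewrite -big_split /=.
by apply: eq_bigr => i _; rewrite mulrDl.
Qed.

Fact fps_one_neq0 : fps_one != 0.
Proof.
apply/eqP => /(congr1 (fun f : fps R => f 0%N)) /= /eqP.
by rewrite oner_eq0.
Qed.

HB.instance Definition _ := GRing.Zmodule_isComNzRing.Build (fps R)
  fps_mulA fps_mulC fps_mul1 fps_mulDl fps_one_neq0.

Fact fps_of_poly_is_zmod_morphism : zmod_morphism fps_of_poly.
Proof. by move=> p q; apply: fpsP => n /=; rewrite coefB. Qed.
Fact fps_of_poly_is_monoid_morphism : monoid_morphism fps_of_poly.
Proof.
by split=> [|p q]; apply: fpsP => n /=; rewrite ?coef1 ?coefM.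
Qed.

HB.instance Definition _ := GRing.isZmodMorphism.Build {poly R} (fps R)
  fps_of_poly fps_of_poly_is_zmod_morphism.
HB.instance Definition _ := GRing.isMonoidMorphism.Build {poly R} (fps R)
  fps_of_poly fps_of_poly_is_monoid_morphism.

Lemma fps_of_poly_inj : injective fps_of_poly.
Proof.
by move=> p q /(congr1 (@coefs R)) eqpq; apply/polyP => n; have := congr1 (@^~ n) eqpq.
Qed.

Definition fps_deriv f : fps R := \fps_n (f n.+1 *+ n.+1).

End Ring.

Notation "p %:S" := (fps_of_poly p)
  (at level 2, left associativity, format "p %:S") : ring_scope.

Section Inverse.
Variable R : comUnitRingType.
Implicit Types f g : fps R.

(* The list of the first [n.+1] coefficients of the inverse of [f]. *)
Fixpoint fps_inv_seq f (n : nat) : seq R :=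
  if n is m.+1 then
    let s := fps_inv_seq f m in
    rcons s (- (f 0%N)^-1 * \sum_(i < m.+1) f i.+1 * s`_(m - i))
  else [:: (f 0%N)^-1].

Definition fps_unit : {pred fps R} := fun f => f 0%N \is a GRing.unit.
Definition fps_inv f : fps R :=
  if f \in fps_unit then \fps_n (fps_inv_seq f n)`_n else f.

Let size_inv_seq f n : size (fps_inv_seq f n) = n.+1.
Proof. by elim: n => //= n IHn; rewrite size_rcons IHn. Qed.

Let inv_seqE f m n : (m <= n)%N ->
  (fps_inv_seq f n)`_m = (fps_inv_seq f m)`_m.
Proof.
elim: n => [|n IHn]; first by rewrite leqn0 => /eqP->.
rewrite leq_eqVlt => /orP[/eqP-> //|lemn].
by rewrite /= nth_rcons size_inv_seq lemn IHn.
Qed.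

Fact fps_mulVx : {in fps_unit, left_inverse 1 fps_inv *%R}.
Proof.
move=> f fU; rewrite mulrC /fps_inv fU; apply: fpsP => -[|n].
  by rewrite /= big_ord1 /= divrr.
rewrite /= big_ord_recl subn0 /= nth_rcons size_inv_seq ltnn eqxx.
rewrite mulNr mulrN mulrA divrr // mul1r addrC; apply/eqP; rewrite subr_eq0.
apply/eqP; apply: eq_bigr => i _; rewrite /bump /= add1n subSS.
by rewrite -(inv_seqE f (leq_subr i n)).
Qed.

Fact fps_unitPl f g : g * f = 1 -> f \in fps_unit.
Proof.
move=> /(congr1 (fun h : fps R => h 0%N)); rewrite /= big_ord1 /= => gf1.
by apply/unitrPr; exists (g 0%N); rewrite mulrC.
Qed.

Fact fps_invr_out : {in [predC fps_unit], fps_inv =1 id}.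
Proof. by move=> f; rewrite inE /fps_inv => /negPf->. Qed.

HB.instance Definition _ := GRing.ComNzRing_hasMulInverse.Build (fps R)
  fps_mulVx fps_unitPl fps_invr_out.

End Inverse.

Definition mid_binom (m : nat) : nat := 'C(m, m./2).

Definition hankel (k n : nat) : rat :=
  \det (\matrix_(i < n, j < n) (mid_binom (k + i + j)%N)%:R).

Definition r_poly (k : nat) : {poly rat} :=
  \prod_(1 <= j < k.+1) (j%:R^-1 *: (j%:R%:P + 'X)) ^+ minn j (k - j)%N.

Definition F_series (a b : nat) : fps rat :=
  iter b (fun f => ('X^(a - 1))%:S * iter a (@fps_deriv rat) f)
         ((1 - 'X)%:S)^-1.

Definition G_const (a b : nat) : rat :=
  \prod_(0 <= j < b) ((a + j)%N`!%:R / j`!%:R).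

Definition G_equation (a b : nat) (G : {poly rat}) : Prop :=
  F_series a b =
    (G_const a b)%:P%:S * ('X^(a - 1))%:S * (G%:S / (1 - 'X)%:S ^+ (a * b + 1)).

(* The unique polynomial satisfying [G_equation a b]; existence is [G_polyP],
   uniqueness is [G_poly_uniq]. *)
Definition G_poly (a b : nat) : {poly rat} :=
  xget 0 [set G | G_equation a b G]%classic.

Lemma fps_derivM (R : comNzRingType) (f g : fps R) :
  fps_deriv (f * g) = fps_deriv f * g + f * fps_deriv g.
Proof.
apply: fpsP => n /=; set N := n.+1.
pose t (h : fps R) : {poly R} := \poly_(i < n.+2) h i.
have tE h i : (i <= n.+1)%N -> (t h)`_i = h i.
  by move=> lei; rewrite coef_poly ltnS lei.
transitivity ((t f * t g)^`()`_n).
  rewrite coef_deriv coefM; congr (_ *+ _); apply: eq_bigr => -[i lti] _ /=.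
  by rewrite !tE // leq_subr.
rewrite derivM coefD !coefM; congr (_ + _); apply: eq_bigr => -[i lti] _ /=.
  by rewrite coef_deriv !tE // (leq_trans (leq_subr _ _)).
by rewrite coef_deriv !tE ?ltnS ?leq_subr // ltnW.
Qed.

Lemma fps_deriv_poly (R : comNzRingType) (p : {poly R}) :
  fps_deriv p%:S = p^`()%:S.
Proof. by apply: fpsP => n /=; rewrite coef_deriv. Qed.

Lemma one_subX_unit (R : comUnitRingType) :
  (1 - 'X : {poly R})%:S \is a GRing.unit.
Proof.
by rewrite unfold_in /= /fps_unit /= coefB coef1 coefX subr0 unitr1.
Qed.

Lemma fps_deriv_one_subX_inv (R : comUnitRingType) (m : nat) :
  let v : fps R := ((1 - 'X)%:S)^-1 in fps_deriv (v ^+ m) = v ^+ m.+1 *+ m.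
Proof.
set u := (1 - 'X)%:S; move=> v; have uU : u \is a GRing.unit := one_subX_unit R.
have D1 : fps_deriv (1 : fps R) = 0 by apply: fpsP => n; rewrite /= mul0rn.
have Dv : fps_deriv v = v ^+ 2.
  have := congr1 (@fps_deriv R) (divrr uU).
  rewrite fps_derivM fps_deriv_poly D1 derivB derivX derivC sub0r.
  rewrite rmorphN rmorph1 mulN1r addrC => /eqP; rewrite subr_eq0 => /eqP uDv.
  by rewrite -[LHS](mulKr uU) uDv expr2.
elim: m => [|m IHm]; first by rewrite expr0 D1 mulr0n.
by rewrite exprS fps_derivM IHm Dv mulrnAr -exprS -exprD mulrS.
Qed.

Lemma fps_deriv_div (R : comUnitRingType) (p : {poly R}) (m : nat) :
  fps_deriv (p%:S / (1 - 'X)%:S ^+ m) =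
    (p^`() * (1 - 'X) + p *+ m)%:S / (1 - 'X)%:S ^+ m.+1.
Proof.
rewrite -!exprVn fps_derivM fps_deriv_poly fps_deriv_one_subX_inv.
have := one_subX_unit R; set u := (1 - 'X : {poly R}) => uU.
rewrite (rmorphD _ (p^`() * u)) (rmorphM _ p^`()) rmorphMn /= mulrDl.
by rewrite -mulrA exprS mulVKr // mulrnAl mulrnAr -exprS.
Qed.

Lemma F_series_div (a b : nat) : (0 < b)%N -> exists P : {poly rat},
  F_series a b = ('X^(a - 1))%:S * (P%:S / (1 - 'X)%:S ^+ (a * b + 1)).
Proof.
have iterD (p : {poly rat}) m k : exists q : {poly rat},
    iter k (@fps_deriv rat) (p%:S / (1 - 'X)%:S ^+ m)
      = q%:S / (1 - 'X)%:S ^+ (k + m).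
  elim: k => [|k [q IHk]]; first by exists p.
  by exists (q^`() * (1 - 'X) + q *+ (k + m)); rewrite iterS IHk fps_deriv_div.
case: b => // b _; elim: b => [|b [P IHb]].
  have [q Eq] := iterD 1 1%N a; exists q; rewrite muln1 -Eq.
  by rewrite /F_series /= rmorph1 mul1r expr1.
have [q Eq] := iterD ('X^(a - 1) * P) (a * b.+1 + 1)%N a; exists q.
rewrite /F_series iterS -/(F_series a b.+1) IHb mulrA -rmorphM Eq.
by rewrite [(a * b.+2)%N]mulnS addnA.
Qed.

Lemma G_const_neq0 (a b : nat) : G_const a b != 0.
Proof.
rewrite /G_const prodf_seq_neq0; apply/allP => j _ /=.
by rewrite mulf_neq0 ?invr_eq0 ?pnatr_eq0 -?lt0n ?fact_gt0.
Qed.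

Lemma G_polyP (a b : nat) : (0 < b)%N -> G_equation a b (G_poly a b).
Proof.
move=> b_gt0; have [P FE] := F_series_div a b_gt0.
apply: (@xgetPex _ 0 [set G | G_equation a b G]%classic) => /=.
have cK : (G_const a b)%:P%:S * (G_const a b)^-1%:P%:S = 1.
  by rewrite -rmorphM -polyCM divff ?G_const_neq0 // rmorph1.
exists ((G_const a b)^-1%:P * P); rewrite /G_equation FE rmorphM /=.
by rewrite -[_ * _ / _]mulrA mulrACA cK mul1r.
Qed.

Lemma G_poly_uniq (a b : nat) (G H : {poly rat}) :
  G_equation a b G -> G_equation a b H -> G = H.
Proof.
rewrite /G_equation => -> /(congr1 (fun f => f * (1 - 'X)%:S ^+ (a * b + 1))).
have := one_subX_unit rat; set u := (1 - 'X)%:S => uU.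
have wU : u ^+ (a * b + 1) \is a GRing.unit by rewrite unitrX.
rewrite -!mulrA !mulVr // !mulr1 -!rmorphM => /fps_of_poly_inj.
move=> /mulfI; rewrite polyC_eq0 G_const_neq0 => /(_ isT).
by move=> /mulfI; rewrite monic_neq0 ?monicXn // => /(_ isT).
Qed.

(* Main.v *)
Require Import Defs.
From HB Require Import structures.
From mathcomp Require Import all_boot all_order all_algebra all_fingroup.
From mathcomp Require Import zify ring.

Import GRing.Theory Num.Theory.
Local Open Scope ring_scope.

(** The coefficient of [x^n] is compared in all series.

    Hankel determinants.  Deleting first and last rows and columns of the matrix
    of [hankel k (n + 2)] leaves Hankel matrices of the same sequence again, with
    the shift [k] raised by one or two.  The Desnanot-Jacobi identity
    ([desnanot_jacobi]) therefore reads
      [D_k(n+2) D_(k+2)(n) = D_k(n+1) D_(k+2)(n+1) - D_(k+1)(n+1)^2],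
    and, as long as [D_(k+2)(n)] is nonzero, it determines all [D_k(n+2)] from
    the values at [n] and [n+1].  The products [r_k(n)] satisfy the same
    recurrence up to the sign [(-1)^k] of the left-hand side ([rval_dodgson]), and
    agree with [D_k] at [n = 0] and [n = 1]; being positive, they also supply
    the nonvanishing.  Hence [D_k(n) = (-1)^(k * 'C(n, 2)) r_k(n)] for all [k]
    ([hankelE]), and the sign disappears for even [k].  Odd [k] cannot be left out
    of the induction, since the recurrence mixes the parities.

    The recurrence for [r_k] is checked through the quotient
    [r_(k+1)(x) / r_k(x)]: raising [k] by one raises the exponent [min(j, k-j)] by
    one exactly for [k/2 < j <= k], so the quotient is the short product
    [half_prod k x], whose changes under [x -> x+1] and [k -> k+1] are single
    factors.

    Differential operators.  [X^(a-1) D^a] maps [x^(n+1)] to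
    [(n+1)^_a x^n], so applying it [b] times to the geometric series gives the
    coefficients [\prod_(1 <= i <= b) (n+i)^_a] ([coef_F_series]).  After
    normalisation, the coefficient of [G_(a,b)(x) / (1-x)^(ab+1)] is MacMahon's
    product [\prod_(i < b, l < a) (n+i+l+1) / (i+l+1)], here [box a b n].
    Adding a row or a column to the box alternately multiplies this product by
    [half_prod], which identifies it with [r_(2k)] for the [k x k] box and with
    [r_(2k+1)] for the [k x (k+1)] box ([rval_box]). *)

(** * Condensation of determinants *)

(** Block elimination clears the upper right block, leaving the Schur complement
    of [A] in the upper left corner. *)
Lemma det_schur (R : comUnitRingType) (m n : nat) (D : 'M[R]_m) (C : 'M_(m, n))
    (B : 'M_(n, m)) (A : 'M_n) :
  A \in unitmx ->
  \det (block_mx D C B A) = \det (D - C *m invmx A *m B) * \det A.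
Proof.
move=> Au.
have -> : block_mx D C B A =
    block_mx 1%:M (C *m invmx A) 0 1%:M
    *m block_mx (D - C *m invmx A *m B) 0 B A.
  rewrite mulmx_block !mul1mx !mul0mx !add0r subrK.
  by rewrite -mulmxA mulVmx // mulmx1.
by rewrite det_mulmx det_ublock det_lblock !det1 !mul1r.
Qed.

Lemma det2 (R : comNzRingType) (M : 'M[R]_2) :
  \det M = M ord0 ord0 * M ord_max ord_max - M ord0 ord_max * M ord_max ord0.
Proof.
rewrite (expand_det_row _ ord0) !big_ord_recl big_ord0 /cofactor !det_mx11 !mxE.
rewrite /= expr0 expr1 mul1r addr0 mulN1r mulrN.
by congr (_ * M _ _ - M _ _ * M _ _); apply: val_inj.
Qed.

Lemma det_permute (R : comNzRingType) (n : nat) (M : 'M[R]_n) (s t : 'S_n) :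
  \det (\matrix_(i, j) M (s i) (t j)) = (-1) ^+ s * (-1) ^+ t * \det M.
Proof.
have -> : \matrix_(i, j) M (s i) (t j) = row_perm s (col_perm t M).
  by apply/matrixP => i j; rewrite !mxE.
rewrite row_permE col_permE !det_mulmx !det_perm odd_permV.
by rewrite mulrCA mulrC mulrAC.
Qed.

(** The cycle [0 -> n], [i+1 -> i]: it moves the last line of a matrix to the
    front, where it borders the block formed by the others. *)
Definition cyc_perm (n : nat) : 'S_n.+1 := lift_perm ord0 ord_max 1.

Lemma cyc_perm0 n : cyc_perm n ord0 = n :> nat.
Proof. by rewrite /cyc_perm lift_perm_id. Qed.

Lemma cyc_permS n (i : 'I_n) : cyc_perm n (lift ord0 i) = i :> nat.
Proof. by rewrite /cyc_perm lift_perm_lift perm1 lift_max. Qed.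

(** Line numbers of the block [1, ..., n] preceded by line [p]. *)
Definition border (p u : nat) : nat := if u is 0 then p else u.

Section Condensation.
Variables (R : comUnitRingType) (n : nat) (a : nat -> nat -> R).

Let A : 'M_n := \matrix_(i, j) a i.+1 j.+1.

(* The Schur complement of the interior block [A] in the matrix obtained by
   bordering it with row [p] and column [q]. *)
Let S (p q : nat) : R :=
  a p q - ((\row_j a p j.+1) *m invmx A *m (\col_i a i.+1 q)) ord0 ord0.

Let det_border p q : A \in unitmx ->
  \det (\matrix_(i < n.+1, j < n.+1) a (border p i) (border q j)) = S p q * \det A.
Proof.
move=> Au.
have -> : \matrix_(i < n.+1, j < n.+1) a (border p i) (border q j) =
   @block_mx _ 1 n 1 n (a p q)%:M (\row_j a p j.+1) (\col_i a i.+1 q) A.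
  apply/matrixP => i j; rewrite !mxE.
  case: splitP => i' Ei; rewrite !mxE; case: splitP => j' Ej;
    by rewrite !mxE Ei Ej ?ord1 //= ?eqxx ?mulr1n.
by rewrite [LHS](det_schur R 1 n) // det_mx11 /S !mxE eqxx mulr1n.
Qed.

(* The lines reordered as [0, n+1, 1, ..., n], so that the interior comes last;
   [corner] lists the first two. *)
Let corner (i : nat) : nat := if i is 0 then 0 else n.+1.
Let outer (u : nat) : nat := if u is v.+1 then border n.+1 v else 0.

Let det_outer : A \in unitmx ->
  \det (\matrix_(i < n.+2, j < n.+2) a (outer i) (outer j)) =
    (S 0 0 * S n.+1 n.+1 - S 0 n.+1 * S n.+1 0) * \det A.
Proof.
move=> Au.
have -> : \matrix_(i < n.+2, j < n.+2) a (outer i) (outer j) =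
   @block_mx _ 2 n 2 n (\matrix_(i, j) a (corner i) (corner j))
     (\matrix_(i, j) a (corner i) j.+1) (\matrix_(i, j) a i.+1 (corner j)) A.
  have outerE1 (i : 'I_2) : outer i = corner i by case: i => -[|[|]].
  apply/matrixP => i j; rewrite !mxE.
  by case: splitP => i' Ei; rewrite !mxE; case: splitP => j' Ej;
     rewrite !mxE Ei Ej ?outerE1.
rewrite [LHS](det_schur R 2 n) // det2; congr (_ * _).
have SE (i j : 'I_2) :
    (\matrix_(i < 2, j < 2) a (corner i) (corner j)
      - (\matrix_(i < 2, j < n) a (corner i) j.+1) *m invmx A
        *m \matrix_(i < n, j < 2) a i.+1 (corner j)) i j
    = S (corner i) (corner j).
  rewrite !mxE /S !mxE; congr (_ - _); apply: eq_bigr => u _.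
  rewrite !mxE; congr (_ * _); apply: eq_bigr => v _; by rewrite !mxE.
by rewrite !SE.
Qed.

(** Each of the five minors is a determinant of Schur complements of the interior
    block [A], times [\det A]; the identity is then the formula for the 2 x 2
    determinant of the entries [S p q] with [p, q] in [{0, n+1}].  Reordering
    the lines costs no sign: the sign of the cycle occurs an even number of times
    in each product. *)
Lemma desnanot_jacobi : \det A \is a GRing.unit ->
  \det (\matrix_(i < n.+2, j < n.+2) a i j) * \det A
  = \det (\matrix_(i < n.+1, j < n.+1) a i j)
      * \det (\matrix_(i < n.+1, j < n.+1) a i.+1 j.+1)
    - \det (\matrix_(i < n.+1, j < n.+1) a i j.+1)
      * \det (\matrix_(i < n.+1, j < n.+1) a i.+1 j).
Proof.
move=> detA_unit; have Au : A \in unitmx by rewrite unitmxE.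
have border0 u : border 0 u = u by case: u.
have borderE (i : 'I_n.+1) : border n.+1 i = (cyc_perm n i).+1.
  case: (unliftP ord0 i) => [j|] ->; first by rewrite cyc_permS.
  by rewrite cyc_perm0.
have outerE (i : 'I_n.+2) : outer i = lift_perm ord0 ord0 (cyc_perm n) i.
  case: (unliftP ord0 i) => [j|] ->; last by rewrite lift_perm_id.
  by rewrite lift_perm_lift /= borderE.
set e : R := (-1) ^+ cyc_perm n.
have ee : e * e = 1 by rewrite -expr2 sqrr_sign.
have E00 := det_border 0 0 Au; have E01 := det_border 0 n.+1 Au.
have E10 := det_border n.+1 0 Au; have E11 := det_border n.+1 n.+1 Au.
have E2 := det_outer Au.
have F00 : \det (\matrix_(i < n.+1, j < n.+1) a i j) = S 0 0 * \det A.
  by rewrite -E00; congr (\det _); apply/matrixP => i j; rewrite !mxE !border0.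
have F11 : \det (\matrix_(i < n.+1, j < n.+1) a i.+1 j.+1)
    = S n.+1 n.+1 * \det A.
  rewrite -E11 -[LHS]mul1r -ee -det_permute; congr (\det _).
  by apply/matrixP => i j; rewrite !mxE !borderE.
have F01 : e * \det (\matrix_(i < n.+1, j < n.+1) a i j.+1) = S 0 n.+1 * \det A.
  have := det_permute _ _ (\matrix_(i, j) a i j.+1) 1 (cyc_perm n).
  rewrite odd_perm1 expr0 mul1r -E01 => <-; congr (\det _).
  by apply/matrixP => i j; rewrite !mxE !borderE border0 perm1.
have F10 : e * \det (\matrix_(i < n.+1, j < n.+1) a i.+1 j) = S n.+1 0 * \det A.
  have := det_permute _ _ (\matrix_(i, j) a i.+1 j) (cyc_perm n) 1.
  rewrite odd_perm1 expr0 mulr1 -E10 => <-; congr (\det _).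
  by apply/matrixP => i j; rewrite !mxE !borderE border0 perm1.
have F2 : \det (\matrix_(i < n.+2, j < n.+2) a i j)
    = (S 0 0 * S n.+1 n.+1 - S 0 n.+1 * S n.+1 0) * \det A.
  rewrite -E2; set s := lift_perm ord0 ord0 (cyc_perm n) in outerE *.
  rewrite -[LHS]mul1r -(sqrr_sign R s) expr2 -det_permute; congr (\det _).
  by apply/matrixP => i j; rewrite !mxE !outerE.
rewrite -[X in _ - X]mul1r -ee [X in _ - X]mulrACA F00 F11 F01 F10 F2.
by ring.
Qed.

End Condensation.

(** * The polynomials [r_k] *)

(** The quotient [r_(k+1)(x) / r_k(x)], see [rval_rec]. *)
Definition half_prod (k x : nat) : rat :=
  \prod_(k./2.+1 <= j < k.+1) ((j + x)%:R / j%:R).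

Lemma half_prod_gt0 k x : 0 < half_prod k x.
Proof.
rewrite /half_prod big_seq prodr_gt0 // => j; rewrite mem_index_iota => /andP[j_gt _].
by rewrite divr_gt0 // ltr0n; lia.
Qed.

(** With the common denominator cleared, both sides are the product of the
    numerators [j + x] over the longer range [k/2 < j <= k+1]. *)
Lemma half_prod_shift k x :
  half_prod k x.+1 * (k./2.+1 + x)%:R = half_prod k x * (k.+1 + x)%:R.
Proof.
have le_half : (k./2.+1 <= k.+1)%N by lia.
rewrite /half_prod !prodf_div mulrAC [RHS]mulrAC; congr (_ / _).
transitivity (\prod_(k./2.+1 <= j < k.+2) (j + x)%:R : rat).
  rewrite mulrC [RHS]big_ltn; last by lia.
  by rewrite [in RHS]big_add1 /=; congr (_ * _); apply: eq_bigr => j _; rewrite addnS.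
by rewrite big_nat_recr.
Qed.

(** The range [(k+1)/2 < j <= k+1] arises from [k/2 < j <= k] by adding [k+1] and,
    if [k] is odd, dropping [(k+1)/2]; the factor [k+1+x-(-1)^k x] is [k+1] or
    [k+1+2x] accordingly. *)
Lemma half_prodS k x :
  half_prod k.+1 x * (k.+1%:R + x%:R - (-1) ^+ k * x%:R)
    = half_prod k x * (k.+1 + x)%:R.
Proof.
have le_half : (k./2.+1 <= k.+1)%N by lia.
have k1 : k.+1%:R != 0 :> rat by rewrite pnatr_eq0.
apply: (mulIf (invr_neq0 k1)).
have -> : half_prod k x * (k.+1 + x)%:R / k.+1%:R
    = \prod_(k./2.+1 <= j < k.+2) ((j + x)%:R / j%:R).
  by rewrite big_nat_recr //= mulrA.
rewrite -signr_odd /half_prod /=; case: (boolP (odd k)) => k_odd; last first.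
  have -> : uphalf k = k./2 by lia.
  by rewrite expr0 mul1r addrK mulfK.
rewrite expr1 mulN1r opprK [RHS]big_ltn; last by lia.
have -> : uphalf k = k./2.+1 by lia.
have -> : k.+1 = k./2.+1.*2 by lia.
by rewrite mulrC -mul2n !natrM natrD; field; rewrite nat1r pnatr_eq0.
Qed.

Lemma horner_r_poly k x : (r_poly k).[x%:R] =
  \prod_(1 <= j < k.+1) ((j + x)%:R / j%:R) ^+ minn j (k - j).
Proof.
rewrite /r_poly horner_prod; apply: eq_bigr => j _.
by rewrite horner_exp hornerZ hornerD hornerC hornerX natrD mulrC.
Qed.

Definition rval (k x : nat) : rat := (r_poly k).[x%:R].

(** The exponent [min(j, k-j)] stays the same for [j <= k/2], where it is [j], and
    grows by one beyond. *)
Lemma rval_rec k x : rval k.+1 x = rval k x * half_prod k x.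
Proof.
rewrite /rval !horner_r_poly big_nat_recr //= subnn minn0 expr0 mulr1.
have le1 : (1 <= k./2.+1)%N by [].
have le2 : (k./2.+1 <= k.+1)%N by lia.
rewrite (big_cat_nat le1 le2) [in RHS](big_cat_nat le1 le2) /= -mulrA; congr (_ * _).
  by apply: eq_big_nat => j ltj; congr (_ ^+ _); lia.
rewrite /half_prod -big_split /=; apply: eq_big_nat => j ltj.
by rewrite -exprSr; congr (_ ^+ _); lia.
Qed.

Lemma rval0 x : rval 0 x = 1.
Proof. by rewrite /rval horner_r_poly big_geq. Qed.

Lemma rval_gt0 k x : 0 < rval k x.
Proof.
by elim: k => [|k IHk]; rewrite ?rval0 // rval_rec mulr_gt0 ?half_prod_gt0.
Qed.

Lemma rval_at0 k : rval k 0 = 1.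
Proof.
elim: k => [|k IHk]; first by rewrite rval0.
rewrite rval_rec IHk mul1r /half_prod big_seq big1 // => j.
rewrite mem_index_iota addn0 => /andP[j_gt _].
by rewrite divff // pnatr_eq0; lia.
Qed.

Lemma mid_binomS k : (mid_binom k.+1 * k./2.+1 = mid_binom k * k.+1)%N.
Proof.
rewrite /mid_binom; have [l [->|->]] : exists l, k = l.*2 \/ k = l.*2.+1.
- by exists k./2; lia.
- rewrite /= uphalf_double doubleK; have := mul_bin_down l.*2.+1 l.
  have -> : (l.*2.+1 - l = l.+1)%N by lia.
  by move=> /= E; rewrite mulnC -E mulnC.
rewrite /= uphalf_double doubleK; have := mul_bin_diag l.*2.+2 l.
by move=> /= E; rewrite mulnC -E mulnC.
Qed.

Lemma rval_at1 k : rval k 1 = (mid_binom k)%:R.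
Proof.
elim: k => [|k IHk]; first by rewrite rval0.
rewrite rval_rec IHk; have := half_prod_shift k 0.
have h_neq0 : k./2.+1%:R != 0 :> rat by rewrite pnatr_eq0.
have -> : half_prod k 0 = 1.
  apply: (mulfI (lt0r_neq0 (rval_gt0 k 0))).
  by rewrite -rval_rec !rval_at0.
rewrite !addn0 mul1r => Eh; apply: (mulIf h_neq0).
by rewrite -mulrA Eh -!natrM mid_binomS.
Qed.

(** Up to sign, the left-hand side of the condensation recurrence is
    [(x+1)/(k+2+x)] times the first product on its right-hand side; the induction
    on [k] works because the left factor in [half_prod_shift] is [k/2+2+x] both
    for [(k, x+1)] and for [(k+2, x)]. *)
Lemma rval_cross k x :
  rval k x.+2 * rval k.+2 x * (k.+2 + x)%:R
    = x.+1%:R * (rval k x.+1 * rval k.+2 x.+1).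
Proof.
elim: k => [|k IHk].
  rewrite !rval_rec !rval0 /half_prod /= !(@big_geq _ _ _ 1 1) // !big_nat1.
  by rewrite !mul1r !divr1.
rewrite rval_rec [rval k.+3 x]rval_rec [rval k.+1 x.+1]rval_rec.
rewrite [rval k.+3 x.+1]rval_rec.
have Ek := half_prod_shift k x.+1; have Ek2 := half_prod_shift k.+2 x.
rewrite addnS -addSn in Ek; rewrite addnS -addSn /= in Ek.
have h_neq0 : (k./2.+2 + x)%:R != 0 :> rat by rewrite pnatr_eq0.
apply: (mulIf h_neq0).
transitivity (rval k x.+2 * rval k.+2 x * (k.+2 + x)%:R
              * (half_prod k x.+1 * (half_prod k.+2 x * (k.+3 + x)%:R))).
  transitivity (rval k x.+2 * rval k.+2 x * (half_prod k.+2 x * (k.+3 + x)%:R)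
                * (half_prod k x.+2 * (k./2.+2 + x)%:R)); first by ring.
  by rewrite Ek; ring.
by rewrite IHk -Ek2 /=; ring.
Qed.

(** Divided by [r_k(x+1) r_(k+2)(x+1)], the last term becomes a quotient of two
    consecutive [half_prod], so that the identity reduces to [half_prodS]. *)
Lemma rval_dodgson k x :
  (-1) ^+ k * (rval k x.+2 * rval k.+2 x)
    = rval k x.+1 * rval k.+2 x.+1 - rval k.+1 x.+1 ^+ 2.
Proof.
have c_neq0 : (k.+2 + x)%:R != 0 :> rat by rewrite pnatr_eq0.
apply: (mulIf c_neq0); rewrite -mulrA rval_cross.
have := half_prodS k x.+1; rewrite addnS -addSn => Eh.
rewrite [rval k.+2 _]rval_rec rval_rec.
transitivity (rval k x.+1 ^+ 2 * half_prod k x.+1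
  * (half_prod k.+1 x.+1 * (k.+2 + x)%:R - half_prod k x.+1 * (k.+2 + x)%:R));
  last by ring.
have -> : (k.+2 + x)%:R = k.+1%:R + x.+1%:R :> rat.
  by rewrite -natrD addnS.
rewrite addSn -addnS natrD in Eh; rewrite -Eh; ring.
Qed.

(** * Evaluation of the Hankel determinants *)

Lemma hankel_dodgson k n : hankel k.+2 n != 0 ->
  hankel k n.+2 * hankel k.+2 n
    = hankel k n.+1 * hankel k.+2 n.+1 - hankel k.+1 n.+1 ^+ 2.
Proof.
pose a i j : rat := (mid_binom (k + i + j))%:R.
(* [c] and [d] count the deleted leading rows and columns.  Only [c + d] matters,
   so that the two mixed minors coincide. *)
have E l m c d : (c + d + k = l)%N ->
    hankel l m = \det (\matrix_(i < m, j < m) a (c + i)%N (d + j)%N).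
  move=> <-; congr (\det _); apply/matrixP => i j; rewrite !mxE.
  by congr (mid_binom _)%:R; lia.
rewrite (E k.+2 n 1 1)%N; last by lia.
rewrite -unitfE => /(desnanot_jacobi rat n a); rewrite expr2.
rewrite (E k n.+2 0 0)%N; last by lia.
rewrite (E k n.+1 0 0)%N; last by lia.
rewrite (E k.+2 n.+1 1 1)%N; last by lia.
rewrite {1}(E k.+1 n.+1 0 1)%N; last by lia.
by rewrite (E k.+1 n.+1 1 0)%N; last by lia.
Qed.

(** Two-step induction on [n], for all shifts at once.  The exponent of the sign
    is forced by the recurrence, as ['C(n+2, 2) = 'C(n, 2) + 2n + 1]. *)
Theorem hankelE k n : hankel k n = (-1) ^+ (k * 'C(n, 2)) * rval k n.
Proof.
suff [] : (forall l, hankel l n = (-1) ^+ (l * 'C(n, 2)) * rval l n) /\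
  (forall l, hankel l n.+1 = (-1) ^+ (l * 'C(n.+1, 2)) * rval l n.+1) by [].
elim: n => [|n [IHn IHn1]].
  split=> l; rewrite muln0 expr0 mul1r.
    by rewrite /hankel det_mx00 rval_at0.
  by rewrite /hankel det_mx11 mxE !addn0 rval_at1.
split=> // l.
pose e m : rat := (-1) ^+ (l * m).
have ee m : e m * e m = 1 by rewrite -expr2 sqrr_sign.
have shift2 m : (-1) ^+ (l.+2 * m) = e m :> rat.
  by rewrite /e !mulSn addnA addnn exprD -mul2n exprM sqrrN expr1n mul1r.
have H_neq0 : hankel l.+2 n != 0.
  by rewrite IHn mulf_neq0 ?signr_eq0 // lt0r_neq0 ?rval_gt0.
have := hankel_dodgson l n H_neq0; rewrite !IHn1 IHn !shift2 -/(e _) => E.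
have eS : e 'C(n.+2, 2) = (-1) ^+ l * e 'C(n, 2).
  have -> : 'C(n.+2, 2) = ('C(n, 2) + n.*2 + 1)%N.
    by rewrite !binS !bin1 bin0; lia.
  rewrite /e !mulnDr !exprD muln1 -mul2n mulnCA mul2n.
  by rewrite -[_ ^+ (_.*2)]signr_odd odd_double expr0 mulr1 mulrC.
apply: (mulIf H_neq0); rewrite IHn shift2 E -/(e _) eS.
transitivity ((-1) ^+ l * (rval l n.+2 * rval l.+2 n) * (e 'C(n, 2) * e 'C(n, 2)));
  last by ring.
by rewrite rval_dodgson ee mulr1 exprMn sqrr_sign mul1r mulrACA ee mul1r.
Qed.

(** * Coefficients of the differential operator series *)

Lemma coef_iter_fps_deriv (R : comNzRingType) (f : fps R) a n :
  iter a (@fps_deriv R) f n = f (n + a)%N *+ (n + a) ^_ a.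
Proof.
elim: a n => [|a IHa] n; first by rewrite addn0 ffactn0.
by rewrite iterS /= IHa addSnnS -mulrnA ffactnSr (_ : n + a.+1 - a = n.+1)%N //; lia.
Qed.

Lemma coef_fpsXnM (R : comNzRingType) (f : fps R) m n :
  (('X^m)%:S * f) (n + m)%N = f n.
Proof.
have lt_m : (m < (n + m).+1)%N by lia.
rewrite /= (bigD1 (Ordinal lt_m)) //= coefXn eqxx mul1r addnK big1 ?addr0 // => i ne_im.
by rewrite coefXn (negPf (ne_im : (i : nat) != m)) mul0r.
Qed.

Lemma coef_fpsXnM_lt (R : comNzRingType) (f : fps R) m n :
  (n < m)%N -> (('X^m)%:S * f) n = 0.
Proof.
move=> lt_nm; rewrite /= big1 // => i _; rewrite coefXn.
by rewrite (_ : (i == m :> nat) = false) ?mul0r //; have := ltn_ord i; lia.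
Qed.

Lemma fps_geometric (R : comUnitRingType) :
  ((1 - 'X)%:S)^-1 = \fps_n 1 :> fps R.
Proof.
apply: (mulrI (one_subX_unit R)); rewrite divrr ?one_subX_unit //.
rewrite rmorphB rmorph1 mulrBl mul1r -['X]expr1; apply: fpsP => n.
rewrite -[RHS]/(1 - (('X^1)%:S * (\fps_n 1)) n); case: n => [|n].
  by rewrite coef_fpsXnM_lt // subr0.
by rewrite -[n.+1]addn1 coef_fpsXnM subrr addn1.
Qed.

(** One application of [X^(a-1) D^a] sends [f] to the series with coefficients
    [f (n+1) * (n+1)^_a].  The formula includes the case [n < a-1], where the power of
    [X] forces a zero, since then the falling factorial vanishes. *)
Lemma coef_F_series a b n : (0 < a)%N ->
  F_series a b n = (\prod_(i < b) (n + i.+1) ^_ a)%N%:R.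
Proof.
move=> a_gt0; elim: b n => [|b IHb] n.
  by rewrite /F_series /= fps_geometric big_ord0.
rewrite /F_series iterS -/(F_series a b).
have [lt_na|le_an] := ltnP n (a - 1).
  by rewrite coef_fpsXnM_lt // big_ord_recl ffact_small ?mul0n //= /bump; lia.
have [m ->] : exists m, n = (m + (a - 1))%N by exists (n - (a - 1))%N; lia.
rewrite coef_fpsXnM coef_iter_fps_deriv IHb -mulrnA.
have <- : (m + (a - 1) + 1 = m + a)%N by lia.
rewrite big_ord_recl mulnC; congr (_ * _)%:R.
by apply: eq_bigr => i _; rewrite /= /bump; congr (_ ^_ _); lia.
Qed.

(** * MacMahon's box product *)

(** MacMahon's count of the plane partitions in an [a x b x x] box. *)
Definition box (a b x : nat) : rat :=
  \prod_(0 <= i < b) \prod_(0 <= l < a) ((x + i + l).+1%:R / (i + l).+1%:R).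

Lemma box_ffact a b x :
  box a b x = \prod_(0 <= i < b) (((x + a + i) ^_ a)%:R / ((a + i) ^_ a)%:R).
Proof.
have ffE y : \prod_(0 <= l < a) (y + l).+1%:R = ((y + a) ^_ a)%:R :> rat.
  elim: a {b} y => [|a IHa] y; first by rewrite big_geq ?ffactn0.
  by rewrite big_nat_recr //= IHa addnS ffactSS natrM mulrC.
apply: eq_bigr => i _; rewrite prodf_div -[(a + i)%N]addnC -ffE; congr (_ / _).
by rewrite addnAC -ffE.
Qed.

Lemma box_symm a b x : box a b x = box b a x.
Proof.
rewrite /box exchange_big; apply: eq_bigr => i _; apply: eq_bigr => l _.
by congr (_%:R / _%:R); lia.
Qed.

Lemma box_recr a b x :
  box a b.+1 x = box a b x * \prod_(b <= j < b + a) ((j.+1 + x)%:R / j.+1%:R).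
Proof.
rewrite /box big_nat_recr //=; congr (_ * _).
rewrite -[X in _ = \prod_(X <= _ < _) _]add0n big_addn addKn; apply: eq_bigr => l _.
by congr (_%:R / _%:R); lia.
Qed.

Lemma half_prodE k x :
  half_prod k x = \prod_(k./2 <= j < k) ((j.+1 + x)%:R / j.+1%:R).
Proof. by rewrite /half_prod big_add1. Qed.

(** Growing the box as [k x k], [k x (k+1)], [(k+1) x (k+1)] multiplies the product
    by the factors of index [k < j <= 2k] and then [k < j <= 2k+1], which are
    those of [half_prod (2k)] and [half_prod (2k+1)]. *)
Lemma rval_box k x :
  rval (2 * k) x = box k k x /\ rval (2 * k + 1) x = box k k.+1 x.
Proof.
have odd_even m : rval (2 * m) x = box m m x -> rval (2 * m + 1) x = box m m.+1 x.
  move=> E; rewrite addn1 rval_rec E box_recr half_prodE addnn mul2n.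
  by rewrite half_double.
have even_odd m : rval (2 * m + 1) x = box m m.+1 x
    -> rval (2 * m.+1) x = box m.+1 m.+1 x.
  move=> E; rewrite (_ : 2 * m.+1 = (2 * m + 1).+1)%N; last by lia.
  rewrite rval_rec E box_symm [RHS]box_recr half_prodE.
  by congr (_ * \prod_(_ <= j < _) _); lia.
suff H : rval (2 * k) x = box k k x by split; last exact: odd_even.
elim: k => [|k IHk]; first by rewrite rval0 /box big_geq.
by apply/even_odd/odd_even.
Qed.

(** The normalising constant [G_const a b] is the denominator of [box a b n], and
    the factor [x^(a-1)] shifts the coefficients of [F_series] by [a-1]. *)
Lemma G_series_coef a b : (0 < a)%N -> (0 < b)%N ->
  (G_poly a b)%:S / (1 - 'X)%:S ^+ (a * b + 1) = \fps_n (box a b n).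
Proof.
move=> a_gt0 b_gt0; apply: fpsP => n; set Q := _ / _.
have := G_polyP a b_gt0; rewrite /G_equation -/Q => E.
have C_neq0 := G_const_neq0 a b.
apply: (mulfI C_neq0).
have scaleE (c : rat) (f : fps rat) m : (c%:P%:S * f) m = c * f m.
  rewrite /= big_ord_recl /= coefC eqxx subn0 big1 ?addr0 // => i _.
  by rewrite coefC mul0r.
have := congr1 (fun f : fps rat => f (n + (a - 1))%N) E.
rewrite -mulrA scaleE coef_fpsXnM coef_F_series // => <-.
rewrite -[X in _ = _ * X]/(box a b n).
rewrite box_ffact big_mkord prodf_div /G_const big_mkord mulrC.
have -> : \prod_(i < b) ((a + i) ^_ a)%:R = \prod_(i < b) ((a + i)`!%:R / i`!%:R) :> rat.
  apply: eq_bigr => i _; apply: (canRL (mulfK _)).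
    by rewrite pnatr_eq0 -lt0n fact_gt0.
  by rewrite -natrM -[in RHS](ffact_fact (leq_addr i a)) addKn.
rewrite divfK //; last by move: C_neq0; rewrite /G_const big_mkord.
rewrite natr_prod; apply: eq_bigr => i _; congr ((_ ^_ _)%:R); lia.
Qed.

Theorem corollary5 (k : nat) (k_ge1 : (1 <= k)%N) :
  (\fps_n hankel (2 * k) n = \fps_n (r_poly (2 * k)).[n%:R]
   /\ \fps_n (r_poly (2 * k)).[n%:R] =
        (G_poly k k)%:S / (1 - 'X)%:S ^+ (k ^ 2 + 1))
  /\ \fps_n (r_poly (2 * k + 1)).[n%:R] =
       (G_poly k k.+1)%:S / (1 - 'X)%:S ^+ (k ^ 2 + k + 1).
Proof.
have -> : (k ^ 2 + k)%N = (k * k.+1)%N by rewrite mulnS addnC -mulnn.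
rewrite -mulnn !G_series_coef //.
split; [split|]; apply: fpsP => n /=.
- by rewrite hankelE -mulnA exprM sqrrN !expr1n mul1r.
- by have [<- _] := rval_box k n.
- by have [_ <-] := rval_box k n.
Qed.
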